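(* Consider the following list of matrices in $M_3(\mathcal D)$ (all Greek parameters are in $K$): (i) $\operatorname{diag}(\alpha_1+\beta_1\zeta,\alpha_2+\beta_2\zeta,\alpha_3+\beta_3\zeta)$ with $\alpha_1,\alpha_2,\alpha_3$ pairwise distinct; (ii) $\begin{pmatrix}A&0\\0&\alpha_4+\beta_4\zeta\end{pmatrix}$, where $A\in M_2(\mathcal D)$ is either $J_{2,\alpha}+\begin{pmatrix}\beta&0\\ \beta'&0\end{pmatrix}\zeta$, or $\alpha E_2+\operatorname{diag}(\gamma,\gamma')\zeta$, or $\alpha E_2+J_{2,\gamma}\zeta$, and where $\alpha_4\neq\alpha$; (iii) $\begin{pmatrix}J_{2,\alpha_5}&0\\0&\alpha_5\end{pmatrix}+\begin{pmatrix}\beta_{11}&0&0\\ \beta_{21}&0&\beta_{23}\\ \beta_{31}&0&\beta_{33}\end{pmatrix}\zeta$, where $\begin{pmatrix}\beta_{21}&\beta_{23}\\ \beta_{31}&\beta_{33}\end{pmatrix}\in\mathcal R_2$; (iv) $J_{3,\alpha_6}+\begin{pmatrix}\beta_5&0&0\\ \beta_6&0&0\\ \beta_7&0&0\end{pmatrix}\zeta$; (v) $\alpha_7E_3+J\zeta$, where $J$ is $\operatorname{diag}(\gamma_1,\gamma_2,\gamma_3)$, or $\begin{pmatrix}J_{2,\gamma_4}&0\\0&\gamma_5\end{pmatrix}$, or $J_{3,\gamma_6}$. Then every matrix in $M_3(\mathcal D)$ is similar to a matrix in this list, and two matrices in the list are similar if and only if they are equal or they are both diagonal matrices (type (i); type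 (ii) with $A=\alpha E_2+\operatorname{diag}(\gamma,\gamma')\zeta$; or type (v) with $J$ diagonal) that differ by a permutation of the diagonal elements.
   Context: $K$ is an algebraically closed field of characteristic zero and $\mathcal D=K[\zeta]$ with $\zeta^2=0$ is the algebra of dual numbers over $K$. Matrices $X,Y\in M_n(\mathcal D)$ are similar if $Y=CXC^{-1}$ for some invertible $C\in M_n(\mathcal D)$. $E_n$ is the identity matrix, and $J_{n,\alpha}$ is the upper triangular Jordan block of order $n$ with eigenvalue $\alpha$ (ones on the superdiagonal). The set $\mathcal R_2\subset M_2(K)$ is $$\mathcal R_2=\left\{\begin{pmatrix}\alpha&0\\0&\beta\end{pmatrix}:\alpha,\beta\in K\right\}\cup\left\{\begin{pmatrix}0&\gamma\\1&0\end{pmatrix}:\gamma\in K\right\}\cup\left\{\begin{pmatrix}0&1\\0&0\end{pmatrix}\right\}.$$ *)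

(* Defs.v *)
From mathcomp Require Import all_boot all_order all_algebra all_fingroup.
Set Implicit Arguments.
Unset Strict Implicit.
Unset Printing Implicit Defensive.
Import GRing.Theory.
Local Open Scope ring_scope.

Section GenericMatrices.

(* Explicit matrix given by the list of its rows. *)
Definition rows_mx (R : nmodType) (m n : nat) (s : seq (seq R)) : 'M[R]_(m, n) :=
  \matrix_(i < m, j < n) (nth [::] s i)`_j.

Definition diag_seq (R : nmodType) (n : nat) (s : seq R) : 'M[R]_n :=
  diag_mx (\row_(j < n) s`_j).

Definition jordan_block (R : pzRingType) (n : nat) (a : R) : 'M[R]_n :=
  \matrix_(i < n, j < n)
    (if j == i then a else if j == i.+1 :> nat then 1 else 0).

(* The direct sum of a 2 x 2 block and a 1 x 1 block. *)
Definition bordered (R : pzRingType) (A : 'M[R]_2) (c : R) : 'M[R]_3 :=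
  block_mx A 0 0 (c%:M : 'M[R]_1).

Definition mx_similar (R : comUnitRingType) (n : nat) (X Y : 'M[R]_n) : Prop :=
  exists C : 'M[R]_n, C \in unitmx /\ Y = C *m X *m invmx C.

Definition diag_permuted (R : nmodType) (n : nat) (X Y : 'M[R]_n) : Prop :=
  exists s : 'S_n, forall i, Y i i = X (s i) (s i).

End GenericMatrices.

(* Dual numbers K[zeta], realised as the quotient ring K[X]/(X^2). *)
Notation dual K := {poly %/ ('X^2 : {poly K})}.

Section Dual.

Variable K : fieldType.

Definition dual_inj (a : K) : dual K := qpolyC ('X^2 : {poly K}) a.
Definition zeta : dual K := qpolyX ('X^2 : {poly K}).

Lemma zeta_sq : zeta ^+ 2 = 0.
Proof.
rewrite /zeta /qpolyX -rmorphXn /=; apply: val_inj => /=.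
by rewrite mk_monic_Xn Pdiv.RingMonic.rmodpp ?monicXn.
Qed.

Definition dualnum (a b : K) : dual K := dual_inj a + dual_inj b * zeta.

Definition dualmx (m n : nat) (A B : 'M[K]_(m, n)) : 'M[dual K]_(m, n) :=
  map_mx dual_inj A + zeta *: map_mx dual_inj B.

Lemma dual_decomp (x : dual K) : exists! ab : K * K, x = dualnum ab.1 ab.2.
Proof.
have valE a b : val (dualnum a b) = a%:P + b%:P * 'X :> {poly K}.
  have zE : val zeta = 'X :> {poly K} by apply: qpolyXE; rewrite ?size_polyXn ?monicXn.
  rewrite /dualnum -[val _]/(a%:P + Pdiv.CommonRing.rmodp ((b%:P : {poly K}) * val zeta) (mk_monic 'X^2)) zE.
  rewrite Pdiv.CommonRing.rmodp_small // mk_monic_Xn size_polyXn /=.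
  by rewrite mul_polyC (leq_ltn_trans (size_scale_leq _ _)) ?size_polyX.
have coefs a b : (dualnum a b)`_0 = a /\ (dualnum a b)`_1 = b.
  rewrite [polyn _]valE !coefD !coefC !coefCM !coefX /= mulr0 mulr1 addr0 add0r.
  by split.
exists (x`_0, x`_1); split; last first.
  by case=> a b /= ->; have [-> ->] := coefs a b.
apply: val_inj; rewrite valE; apply/polyP=> i /=.
rewrite coefD coefC coefCM coefX; case: i => [|[|i]] /=;
  rewrite ?mulr0 ?mulr1 ?addr0 ?add0r //.
have sx : (size (val x) < 3)%N.
  by apply: leq_trans (size_mk_monic x) _; rewrite mk_monic_Xn size_polyXn.
by rewrite nth_default // (leq_trans (_ : size (val x) <= 2)%N).
Qed.

End Dual.

Section CanonicalForms.

Variable K : fieldType.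
Implicit Types (J : 'M[K]_3) (X : 'M[dual K]_3).

Definition R2 (M : 'M[K]_2) : Prop :=
  [\/ exists a b : K, M = rows_mx 2 2 [:: [:: a; 0]; [:: 0; b]],
      exists c : K, M = rows_mx 2 2 [:: [:: 0; c]; [:: 1; 0]]
    | M = rows_mx 2 2 [:: [:: 0; 1]; [:: 0; 0]]].

Definition form_i X : Prop :=
  exists a1 a2 a3 b1 b2 b3 : K,
    [/\ a1 != a2, a1 != a3 & a2 != a3] /\
    X = diag_seq 3 [:: dualnum a1 b1; dualnum a2 b2; dualnum a3 b3].

(* The three families of 2 x 2 blocks used in [form_ii]; [a] is the eigenvalue
   of the reduction of the block modulo zeta. *)
Definition block_jordan (a : K) (A : 'M[dual K]_2) : Prop :=
  exists b b' : K,
    A = dualmx (jordan_block 2 a) (rows_mx 2 2 [:: [:: b; 0]; [:: b'; 0]]).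

Definition block_diag (a : K) (A : 'M[dual K]_2) : Prop :=
  exists c c' : K, A = dualmx a%:M (diag_seq 2 [:: c; c']).

Definition block_scalar_jordan (a : K) (A : 'M[dual K]_2) : Prop :=
  exists c : K, A = dualmx a%:M (jordan_block 2 c).

Definition form_ii (block : K -> 'M[dual K]_2 -> Prop) X : Prop :=
  exists (a a4 b4 : K) (A : 'M[dual K]_2),
    [/\ block a A, a4 != a & X = bordered A (dualnum a4 b4)].

Definition form_iii X : Prop :=
  exists a5 b11 b21 b23 b31 b33 : K,
    R2 (rows_mx 2 2 [:: [:: b21; b23]; [:: b31; b33]]) /\
    X = dualmx (bordered (jordan_block 2 a5) a5)
               (rows_mx 3 3 [:: [:: b11; 0; 0];
                                [:: b21; 0; b23];
                                [:: b31; 0; b33]]).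

Definition form_iv X : Prop :=
  exists a6 b5 b6 b7 : K,
    X = dualmx (jordan_block 3 a6)
               (rows_mx 3 3 [:: [:: b5; 0; 0]; [:: b6; 0; 0]; [:: b7; 0; 0]]).

(* The three shapes of the coefficient of zeta in [form_v]. *)
Definition jordan111 J : Prop :=
  exists c1 c2 c3 : K, J = diag_seq 3 [:: c1; c2; c3].

Definition jordan21 J : Prop :=
  exists c4 c5 : K, J = bordered (jordan_block 2 c4) c5.

Definition jordan3 J : Prop := exists c6 : K, J = jordan_block 3 c6.

Definition form_v (shape : 'M[K]_3 -> Prop) X : Prop :=
  exists (a7 : K) (J : 'M[K]_3), shape J /\ X = dualmx a7%:M J.

Definition in_list X : Prop :=
  form_i X
  \/ [\/ form_ii block_jordan X, form_ii block_diag X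
        | form_ii block_scalar_jordan X]
  \/ form_iii X
  \/ form_iv X
  \/ [\/ form_v jordan111 X, form_v jordan21 X | form_v jordan3 X].

Definition diagonal_type X : Prop :=
  [\/ form_i X, form_ii block_diag X | form_v jordan111 X].

End CanonicalForms.

(* Main.v *)
Require Import Defs.
From HB Require Import structures.
From mathcomp Require Import all_boot all_order all_algebra all_fingroup.
From mathcomp Require Import ring.
Set Implicit Arguments.
Unset Strict Implicit.
Unset Printing Implicit Defensive.
Import GRing.Theory.
Local Open Scope ring_scope.

(* Conjugating A + B zeta by an invertible P + Q zeta yields A' + B' zeta exactly
   when A' P = P A and B' P + A' Q = P B + Q A.  Hence A can be put in Jordan
   form, and then B only matters modulo the commutators [Q, A] and up to the
   action of the centraliser of A; for each Jordan form this small action is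
   normalised by explicit P and Q.

   For uniqueness, two similar diagonal matrices over the local ring of dual
   numbers agree up to a permutation.  The A-part of a non-diagonal member of the
   list is upper triangular with diagonal (a, a, d), so trace and characteristic
   polynomial recover a and d; comparing the entries of the two equations above
   then recovers the rest, and an A' + B' zeta that is diagonal would force the
   first column of P to vanish. *)

(** * Similarity over a commutative ring *)

Section Similarity.

Variable R : comUnitRingType.

Lemma mx_similarP n (X Y : 'M[R]_n) :
  mx_similar X Y <-> exists C, C \in unitmx /\ Y *m C = C *m X.
Proof.
split=> [[C [uC ->]] | [C [uC eYC]]]; exists C; split=> //.
  by rewrite mulmxKV.
by rewrite -eYC mulmxK.
Qed.

Lemma mx_similar_refl n (X : 'M[R]_n) : mx_similar X X.
Proof. by apply/mx_similarP; exists 1%:M; rewrite unitmx1 mulmx1 mul1mx. Qed.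

Lemma mx_similar_sym n (X Y : 'M[R]_n) : mx_similar X Y -> mx_similar Y X.
Proof.
case=> C [uC ->]; exists (invmx C); rewrite unitmx_inv uC invmxK; split=> //.
by rewrite !mulmxA mulVmx // mul1mx mulmxKV.
Qed.

Lemma mx_similar_trans n (X Y Z : 'M[R]_n) :
  mx_similar X Y -> mx_similar Y Z -> mx_similar X Z.
Proof.
move=> /mx_similarP[C [uC eC]] /mx_similarP[D [uD eD]].
apply/mx_similarP; exists (D *m C); rewrite unitmx_mul uD; split=> //.
by rewrite mulmxA eD -mulmxA eC mulmxA.
Qed.

Lemma diag_permuted_similar n (X Y : 'M[R]_n) :
  is_diag_mx X -> is_diag_mx Y -> diag_permuted X Y -> mx_similar X Y.
Proof.
move=> dX dY [s eYX]; apply/mx_similarP; exists (perm_mx s).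
rewrite unitmx_perm -row_permE; split=> //; apply/matrixP=> i j.
rewrite !mxE (bigD1 i) //= big1 => [|k ki]; last first.
  by rewrite (is_diag_mxP dY) ?mul0r 1?eq_sym.
rewrite addr0 !mxE; have [<- | ne] := eqVneq (s i) j; first by rewrite mulr1 eYX.
by rewrite mulr0 (is_diag_mxP dX).
Qed.

End Similarity.

(** * Matrices over the dual numbers *)

Section DualNumbers.

Variable K : fieldType.
Implicit Types (a b : K).

HB.instance Definition _ := GRing.RMorphism.copy (@dual_inj K) (@qpolyC K 'X^2).

Lemma zetaM : zeta K * zeta K = 0.
Proof. by rewrite -expr2 zeta_sq. Qed.

Lemma dualnum_inj a b a' b' :
  dualnum a b = dualnum a' b' -> a = a' /\ b = b'.
Proof.
move=> e; have [uv [_ inj]] := dual_decomp (dualnum a b).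
by have:= inj (a', b') e; rewrite (inj (a, b) (erefl _)) => -[-> ->].
Qed.

Lemma dualnumP (x : dual K) : exists a b, x = dualnum a b.
Proof. by have [[a b] /= [-> _]] := dual_decomp x; exists a, b. Qed.

Lemma dualnum00 : dualnum 0 0 = 0 :> dual K.
Proof. by rewrite /dualnum !rmorph0 mul0r addr0. Qed.

Lemma dualnum10 : dualnum 1 0 = 1 :> dual K.
Proof. by rewrite /dualnum rmorph0 rmorph1 mul0r addr0. Qed.

Lemma dualnumM a b a' b' :
  dualnum a b * dualnum a' b' = dualnum (a * a') (a * b' + b * a').
Proof.
rewrite /dualnum !rmorphD !rmorphM /=; set z := zeta K.
(* The two sides differ only by the [zeta ^+ 2] term of the expanded product. *)
by apply/eqP; rewrite -subr_eq0; apply/eqP; transitivity (dual_inj b * dual_inj b' * (z * z));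
  [ring | rewrite zetaM mulr0].
Qed.

Variable n : nat.

Lemma dualmxE m (A B : 'M[K]_(m, n)) i j : dualmx A B i j = dualnum (A i j) (B i j).
Proof. by rewrite !mxE /dualnum [zeta K * _]mulrC. Qed.

Lemma dualmx_inj m (A B A' B' : 'M[K]_(m, n)) :
  dualmx A B = dualmx A' B' -> A = A' /\ B = B'.
Proof.
move=> e; have eij i j : A i j = A' i j /\ B i j = B' i j.
  by apply: dualnum_inj; rewrite -!dualmxE e.
by split; apply/matrixP=> i j; have [] := eij i j.
Qed.

Lemma dualmxP m (X : 'M[dual K]_(m, n)) : exists A B, X = dualmx A B.
Proof.
(* Stating the equation as a boolean lets [sigW] choose components for all entries at once. *)
have coef (x : dual K) : {ab : K * K | x == dualnum ab.1 ab.2}.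
  by apply: sigW; have [a [b ->]] := dualnumP x; exists (a, b).
exists (\matrix_(i, j) (sval (coef (X i j))).1).
exists (\matrix_(i, j) (sval (coef (X i j))).2).
by apply/matrixP=> i j; rewrite dualmxE !mxE; case: (coef _) => ab /= /eqP.
Qed.

Lemma dualmxM (A B A' B' : 'M[K]_n) :
  dualmx A B *m dualmx A' B' = dualmx (A *m A') (A *m B' + B *m A').
Proof.
rewrite /dualmx mulmxDl !mulmxDr -!scalemxAl -!scalemxAr -!map_mxM scalerA zetaM.
by rewrite scale0r addr0 map_mxD scalerDr addrA.
Qed.

Lemma dualmx1 : dualmx 1%:M 0 = 1%:M :> 'M[dual K]_n.
Proof. by rewrite /dualmx map_mx0 scaler0 addr0 map_mx1. Qed.

Lemma unitmx_dualmx (P Q : 'M[K]_n) : (dualmx P Q \in unitmx) = (P \in unitmx).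
Proof.
have inj1 (M N : 'M[K]_n) : dualmx M N = 1%:M -> M = 1%:M.
  by rewrite -dualmx1 => /dualmx_inj[].
apply/idP/idP=> [uC | uP].
  have [P' [Q' eC]] := dualmxP (invmx (dualmx P Q)).
  move: (mulmxV uC); rewrite eC dualmxM => /inj1/mulmx1_unit uP.
  exact: (proj1 uP).
(* The inverse of P + Q zeta is its geometric series, cut after the linear term because [zeta]
   squares to zero. *)
have e : dualmx P Q *m dualmx (invmx P) (- (invmx P *m Q *m invmx P)) = 1%:M.
  by rewrite dualmxM mulmxV // mulmxN !mulmxA mulmxV // mul1mx addNr dualmx1.
exact: (proj1 (mulmx1_unit e)).
Qed.

Lemma dualmx_similarP (A B A' B' : 'M[K]_n) :
  mx_similar (dualmx A B) (dualmx A' B') <->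
  exists P Q, [/\ P \in unitmx, A' *m P = P *m A
                & B' *m P + A' *m Q = P *m B + Q *m A].
Proof.
rewrite mx_similarP; split=> [[C] | [P [Q [uP eA eB]]]].
  have [P [Q ->]] := dualmxP C; rewrite unitmx_dualmx (dualmxM A' B') (dualmxM P Q) => -[uP].
  by case/dualmx_inj=> eA eB; exists P, Q; split=> //; rewrite addrC.
by exists (dualmx P Q); rewrite unitmx_dualmx (dualmxM A' B') (dualmxM P Q) eA addrC eB.
Qed.

Lemma is_diag_dualmx (A B : 'M[K]_n) :
  is_diag_mx (dualmx A B) = is_diag_mx A && is_diag_mx B.
Proof.
apply/is_diag_mxP/andP=> [dX | [/is_diag_mxP dA /is_diag_mxP dB] i j ne].
  split; apply/is_diag_mxP=> i j ne; move: (dX i j ne);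
    by rewrite dualmxE -dualnum00 => /dualnum_inj[].
by rewrite dualmxE dA // dB // dualnum00.
Qed.

(* The determinant of a conjugating matrix is nonzero modulo zeta, so some term
   of its Leibniz expansion has all its factors invertible. *)
Lemma diag_similar_permuted (X Y : 'M[dual K]_n) :
  is_diag_mx X -> is_diag_mx Y -> mx_similar X Y -> diag_permuted X Y.
Proof.
move=> dX dY /mx_similarP[C []].
have [P [Q eC]] := dualmxP C; rewrite eC unitmx_dualmx -eC => uP eYC.
have [s nzs] : exists s : 'S_n, \prod_i P i (s i) != 0.
  apply/existsP; apply: contraLR uP => /existsPn all0.
  rewrite unitmxE unitfE negbK; apply/eqP/big1 => s _.
  by have := all0 s; rewrite negbK => /eqP->; rewrite mulr0.
exists s => i; have nzP : P i (s i) != 0.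
  by apply: contraNneq nzs => P0; rewrite (bigD1 i) //= P0 mul0r.
(* For diagonal [X] and [Y] this entry reads y c = c x, and c is a unit because its reduction
   [P i (s i)] is nonzero; cancelling c gives y = x. *)
have : (Y *m C) i (s i) = (C *m X) i (s i) by rewrite eYC.
rewrite !mxE (bigD1 i) //= big1 => [|k ki]; last first.
  by rewrite (is_diag_mxP dY) ?mul0r 1?eq_sym.
rewrite (bigD1 (s i)) //= big1 => [|k ki]; last by rewrite (is_diag_mxP dX) ?mulr0.
rewrite !addr0 eC dualmxE.
have inv : dualnum (P i (s i)) (Q i (s i)) *
    dualnum (P i (s i))^-1 (- (Q i (s i) / P i (s i) ^+ 2)) = 1.
  by rewrite dualnumM -dualnum10; congr dualnum; field.
by move/(congr1 (fun x => x * dualnum (P i (s i))^-1 (- (Q i (s i) / P i (s i) ^+ 2))));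
  rewrite -!mulrA inv mulr1 mulrCA inv mulr1.
Qed.

End DualNumbers.

(** * Explicit matrices of order 3 *)

Definition mat3 (R : nmodType) (a b c d e f g h i : R) : 'M[R]_3 :=
  rows_mx 3 3 [:: [:: a; b; c]; [:: d; e; f]; [:: g; h; i]].

Section Mat3.

Variable R : comNzRingType.
Implicit Types a b c d e f g h i : R.

Lemma eq_mx3 (S : Type) (M N : 'M[S]_3) :
  (forall i j : 'I_3, M i j = N i j) <->
  [/\ M 0 0 = N 0 0, M 0 1 = N 0 1 & M 0 2 = N 0 2] /\
  [/\ M 1 0 = N 1 0, M 1 1 = N 1 1 & M 1 2 = N 1 2] /\
  [/\ M 2 0 = N 2 0, M 2 1 = N 2 1 & M 2 2 = N 2 2].
Proof.
split=> [e // | [[? ? ?] [[? ? ?] [? ? ?]]] i j].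
have ord3 (k : 'I_3) : [\/ k = 0, k = 1 | k = 2].
  by case: k => -[|[|[|k]]] // ltk; [constructor 1|constructor 2|constructor 3];
     apply: val_inj.
by case: (ord3 i) => ->; case: (ord3 j) => ->.
Qed.

Lemma mat3P (M : 'M[R]_3) :
  exists a b c d e f g h i, M = mat3 a b c d e f g h i.
Proof.
exists (M 0 0), (M 0 1), (M 0 2), (M 1 0), (M 1 1), (M 1 2), (M 2 0), (M 2 1), (M 2 2).
by apply/matrixP/eq_mx3; rewrite !mxE.
Qed.

Lemma mat3_inj a b c d e f g h i a' b' c' d' e' f' g' h' i' :
  mat3 a b c d e f g h i = mat3 a' b' c' d' e' f' g' h' i' ->
  [/\ a = a', b = b' & c = c'] /\ [/\ d = d', e = e' & f = f'] /\
  [/\ g = g', h = h' & i = i'].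
Proof. by move/matrixP/eq_mx3; rewrite !mxE. Qed.

Lemma mat3M a b c d e f g h i a' b' c' d' e' f' g' h' i' :
  mat3 a b c d e f g h i *m mat3 a' b' c' d' e' f' g' h' i' =
  mat3 (a * a' + b * d' + c * g') (a * b' + b * e' + c * h') (a * c' + b * f' + c * i')
       (d * a' + e * d' + f * g') (d * b' + e * e' + f * h') (d * c' + e * f' + f * i')
       (g * a' + h * d' + i * g') (g * b' + h * e' + i * h') (g * c' + h * f' + i * i').
Proof.
by apply/matrixP/eq_mx3; rewrite !mxE !big_ord_recl !big_ord0 !mxE /= !addr0 !addrA.
Qed.

Lemma mat3D a b c d e f g h i a' b' c' d' e' f' g' h' i' :
  mat3 a b c d e f g h i + mat3 a' b' c' d' e' f' g' h' i' =
  mat3 (a + a') (b + b') (c + c') (d + d') (e + e') (f + f') (g + g') (h + h') (i + i').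
Proof. by apply/matrixP/eq_mx3; rewrite !mxE. Qed.

Lemma det_mat3 a b c d e f g h i :
  \det (mat3 a b c d e f g h i) =
  a * (e * i - f * h) - b * (d * i - f * g) + c * (d * h - e * g).
Proof.
rewrite (expand_det_row _ 0) !big_ord_recl big_ord0 /cofactor.
rewrite !(expand_det_row _ 0) !big_ord_recl !big_ord0 /cofactor !det_mx11 !mxE /=.
rewrite /bump /= !expr0 !expr1 !addn0 !add0n; ring.
Qed.

Lemma mxtrace_mat3 a b c d e f g h i : \tr (mat3 a b c d e f g h i) = a + e + i.
Proof. by rewrite /mxtrace !big_ord_recl big_ord0 !mxE /= addr0 addrA. Qed.

Lemma scalar_mat3 a : a%:M = mat3 a 0 0 0 a 0 0 0 a.
Proof. by apply/matrixP/eq_mx3; rewrite !mxE. Qed.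

Lemma jordan3_mat3 a : jordan_block 3 a = mat3 a 1 0 0 a 1 0 0 a.
Proof. by apply/matrixP/eq_mx3; rewrite !mxE. Qed.

Lemma diag_mat3 a b c : diag_seq 3 [:: a; b; c] = mat3 a 0 0 0 b 0 0 0 c.
Proof. by apply/matrixP/eq_mx3; rewrite !mxE. Qed.

Lemma bordered_mat3 (A : 'M[R]_2) d :
  bordered A d = mat3 (A 0 0) (A 0 1) 0 (A 1 0) (A 1 1) 0 0 0 d.
Proof.
(* [block_mx] is indexed by [2 + 1], so the indices are rewritten as left and right shifts before
   the block lemmas can apply. *)
have e0 : (0 : 'I_3) = lshift 1 (0 : 'I_2) by apply: val_inj.
have e1 : (1 : 'I_3) = lshift 1 (1 : 'I_2) by apply: val_inj.
have e2 : (2 : 'I_3) = rshift 2 (0 : 'I_1) by apply: val_inj.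
have ul (i j : 'I_2) : bordered A d (lshift 1 i) (lshift 1 j) = A i j by apply: block_mxEul.
have ur (i : 'I_2) (j : 'I_1) : bordered A d (lshift 1 i) (rshift 2 j) = 0
  by rewrite [LHS](@block_mxEur _ 2 1 2 1) mxE.
have dl (i : 'I_1) (j : 'I_2) : bordered A d (rshift 2 i) (lshift 1 j) = 0
  by rewrite [LHS](@block_mxEdl _ 2 1 2 1) mxE.
have dr : bordered A d (rshift 2 0) (rshift 2 0) = d
  by rewrite [LHS](@block_mxEdr _ 2 1 2 1) mxE.
by apply/matrixP/eq_mx3; rewrite e2 e1 e0 !ul !ur !dl dr !mxE.
Qed.

Lemma is_diag_mat3 a b c d e f g h i :
  is_diag_mx (mat3 a b c d e f g h i) <->
  [/\ b = 0, c = 0 & d = 0] /\ [/\ f = 0, g = 0 & h = 0].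
Proof.
split=> [/is_diag_mxP dM | [[-> -> ->] [-> -> ->]]].
  by split; split; [move: (dM 0 1 isT)|move: (dM 0 2 isT)|move: (dM 1 0 isT)
    |move: (dM 1 2 isT)|move: (dM 2 0 isT)|move: (dM 2 1 isT)]; rewrite mxE.
by rewrite -diag_mat3 /diag_seq diag_mx_is_diag.
Qed.

End Mat3.

(** * Explicit forms split into reduction and zeta-part *)

Section DualMat3.

Variable K : fieldType.

Lemma bordered_dualmx (A B : 'M[K]_2) (a b : K) :
  bordered (dualmx A B) (dualnum a b) = dualmx (bordered A a) (bordered B b).
Proof.
rewrite !bordered_mat3; apply/matrixP/eq_mx3.
by rewrite !dualmxE !mxE /= !dualnum00.
Qed.

Lemma diag_seq_dualnum (a1 a2 a3 b1 b2 b3 : K) :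
  diag_seq 3 [:: dualnum a1 b1; dualnum a2 b2; dualnum a3 b3] =
  dualmx (diag_seq 3 [:: a1; a2; a3]) (diag_seq 3 [:: b1; b2; b3]).
Proof.
rewrite !diag_mat3; apply/matrixP/eq_mx3.
by rewrite !dualmxE !mxE /= !dualnum00.
Qed.

End DualMat3.

(** * Jordan normal form in orders 2 and 3 *)

Section JordanForm.

Variable K : closedFieldType.
Implicit Types a b c d e : K.

Lemma mat3_conj (A J : 'M[K]_3) p q r s t u v w x :
  p * (t * x - u * w) - q * (s * x - u * v) + r * (s * w - t * v) != 0 ->
  J *m mat3 p q r s t u v w x = mat3 p q r s t u v w x *m A -> mx_similar A J.
Proof.
move=> nz e; apply/mx_similarP; exists (mat3 p q r s t u v w x); split=> //.
by rewrite unitmxE det_mat3 unitfE.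
Qed.

Lemma quadratic_root b c : exists x, x ^+ 2 = b * x + c.
Proof.
have [x e] := @solve_monicpoly K 2 (fun i => if i == 0%N then c else b) isT.
by exists x; rewrite e !big_ord_recl big_ord0 /= expr0 mulr1 expr1 addr0 addrC.
Qed.

(* [(p, q; r, s)] conjugates [(a, b; d, e)] to the Jordan matrix [(x, t; 0, y)]. *)
Lemma jordan_form2 a b d e : exists p q r s x t y,
  [/\ p * s - q * r != 0, t = 0 \/ t = 1 /\ y = x
    & [/\ x * p + t * r = p * a + q * d, x * q + t * s = p * b + q * e,
          y * r = r * a + s * d & y * s = r * b + s * e]].
Proof.
have [-> | nz_d] := eqVneq d 0.
  have [<- | ne] := eqVneq a e; last first.
    have nz : a - e != 0 by rewrite subr_eq0.
    exists 1, (b / (a - e)), 0, 1, a, 0, e; rewrite mulr0 subr0 mulr1 oner_neq0.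
    by split=> //; [left | split; field].
  have [-> | nz_b] := eqVneq b 0.
    exists 1, 0, 0, 1, a, 0, a; rewrite mulr0 subr0 mulr1 oner_neq0.
    by split=> //; [left | split; ring].
  exists 1, 0, 0, b, a, 1, a; rewrite mulr0 subr0 mul1r nz_b.
  by split=> //; [right | split; ring].
(* The number [y] is an eigenvalue and the other one is [a + e - y]. Since [d] is nonzero,
   [(d, y - a)] is a left eigenvector for [y], and likewise for the other eigenvalue. Distinct
   eigenvalues give two such rows; for a double one, [(0, 1)] is the generalised left eigenvector
   placed above. *)
have [y def_y] := quadratic_root (a + e) (b * d - a * e).
have [def_e | ne] := eqVneq (a + e - y) y.
  exists 0, 1, d, (y - a), y, 1, y; rewrite mul0r sub0r mul1r oppr_eq0 nz_d.
  have {}def_e : e = y + y - a by transitivity (a + e - y + y - a); [ring | rewrite def_e].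
  split=> //; [by right | split; try ring; first by rewrite def_e; ring].
  have -> : y * (y - a) = y ^+ 2 - y * a by ring.
  by rewrite def_y def_e; ring.
exists d, (a + e - y - a), d, (y - a), (a + e - y), 0, y; split; [ | by left | ].
  have -> : d * (y - a) - (a + e - y - a) * d = d * (y - (a + e - y)) by ring.
  by rewrite mulf_neq0 // subr_eq0 eq_sym.
have yy : y * y = (a + e) * y + (b * d - a * e) by rewrite -expr2.
split; try ring.
  have -> : (a + e - y) * (a + e - y - a) + 0 * (y - a) =
     y * y - (a + e) * y + e * (a + e - y) by ring.
  by rewrite yy; ring.
have -> : y * (y - a) = y * y - y * a by ring.
by rewrite yy; ring.
Qed.

(* A left eigenvector is completed to a basis as its last vector. *)
Lemma mat3_last_row (A : 'M[K]_3) :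
  exists a b u d e v c, mx_similar A (mat3 a b u d e v 0 0 c).
Proof.
have [c [V eV nzV]] : exists c, exists2 V : 'rV_3, V *m A = c *: V & V != 0.
  have /closed_rootP[c] : size (char_poly A) != 1%N by rewrite size_char_poly.
  by rewrite -eigenvalue_root_char => /eigenvalueP[V]; exists c, V.
have [a [b [u [d [e [v [g [h [i eA]]]]]]]]] := mat3P A; rewrite {}eA in eV *.
set x := V 0 0; set y := V 0 1; set z := V 0 2.
have ex : x * a + y * d + z * g = c * x.
  move/matrixP/(_ 0 0): eV; rewrite !mxE !big_ord_recl big_ord0 !mxE /= addr0 addrA => <-.
  by congr (_ * _ + V _ _ * _ + V _ _ * _); apply: val_inj.
have ey : x * b + y * e + z * h = c * y.
  move/matrixP/(_ 0 1): eV; rewrite !mxE !big_ord_recl big_ord0 !mxE /= addr0 addrA => <-.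
  by congr (_ * _ + V _ _ * _ + V _ _ * _); apply: val_inj.
have ez : x * u + y * v + z * i = c * z.
  move/matrixP/(_ 0 2): eV; rewrite !mxE !big_ord_recl big_ord0 !mxE /= addr0 addrA => <-.
  by congr (_ * _ + V _ _ * _ + V _ _ * _); apply: val_inj.
(* A nonzero coordinate of [V] serves as pivot: the conjugating matrix has [V] as last row and,
   above it, the two unit vectors of the other coordinates. *)
have [z0 | nz] := eqVneq z 0; last first.
  exists (a - u * x / z), (b - u * y / z), (u / z).
  exists (d - v * x / z), (e - v * y / z), (v / z), c.
  apply: (@mat3_conj _ _ 1 0 0 0 1 0 x y z).
    by rewrite !(mul0r, mul1r, mulr0, subr0, addr0).
  by rewrite !mat3M ex ey ez; congr mat3; field.
have [y0 | ny] := eqVneq y 0; last first.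
  exists (a - b * x / y), u, (b / y), (g - h * x / y), i, (h / y), c.
  apply: (@mat3_conj _ _ 1 0 0 0 0 1 x y z).
    by rewrite z0 !(mul0r, mul1r, mulr0, sub0r, subr0, addr0) oppr_eq0.
  by rewrite !mat3M ex ey ez z0; congr mat3; field.
have nx : x != 0.
  apply: contraNneq nzV => x0; apply/eqP/rowP=> j; rewrite mxE.
  by case: j => -[|[|[|j]]] // lt_j; [rewrite -x0|rewrite -y0|rewrite -z0]; congr (V _ _);
     apply: val_inj.
exists (e - d * y / x), v, (d / x), h, i, (g / x), c.
apply: (@mat3_conj _ _ 0 1 0 0 0 1 x y z).
  by rewrite z0 y0 !(mul0r, mul1r, mulr0, sub0r, subr0, add0r, addr0) opprK.
by rewrite !mat3M ex ey ez z0 y0; congr mat3; field.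
Qed.

Lemma jordan21_mat3 (R : comNzRingType) (a c : R) :
  bordered (jordan_block 2 a) c = mat3 a 1 0 0 a 0 0 0 c.
Proof. by rewrite bordered_mat3 !mxE. Qed.

(** Three layers of reduction: a left eigenvector makes the matrix block triangular, the 2 x 2
    corner is put in Jordan form, and the last column [(y, z)] is cleared or normalised according to
    which eigenvalues coincide. *)
Lemma jordan_form3 (A : 'M[K]_3) :
  exists J, [\/ jordan111 J, jordan21 J | jordan3 J] /\ mx_similar A J.
Proof.
have diagE x y z : [\/ jordan111 (mat3 x 0 0 0 y 0 0 0 z),
    jordan21 (mat3 x 0 0 0 y 0 0 0 z) | jordan3 (mat3 x 0 0 0 y 0 0 0 z)].
  by constructor 1; exists x, y, z; rewrite diag_mat3.
have j21E x y : [\/ jordan111 (mat3 x 1 0 0 x 0 0 0 y),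
    jordan21 (mat3 x 1 0 0 x 0 0 0 y) | jordan3 (mat3 x 1 0 0 x 0 0 0 y)].
  by constructor 2; exists x, y; rewrite jordan21_mat3.
have [a0 [b0 [u [d0 [e0 [v [c simA]]]]]]] := mat3_last_row A.
have [p [q [r [s [a [t [b [nz t01 [e1 e2 e3 e4]]]]]]]]] := jordan_form2 a0 b0 d0 e0.
have [y [z simT]] : exists y z, mx_similar A (mat3 a t y 0 b z 0 0 c).
  exists (p * u + q * v), (r * u + s * v); apply: mx_similar_trans simA _.
  apply: (@mat3_conj _ _ p q 0 r s 0 0 0 1).
    by rewrite !(mulr0, mulr1, subr0, mul0r, addr0).
  by rewrite !mat3M -e1 -e2 -e3 -e4; congr mat3; ring.
suff [J [jJ simJ]] : exists J, [\/ jordan111 J, jordan21 J | jordan3 J] /\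
    mx_similar (mat3 a t y 0 b z 0 0 c) J.
  by exists J; split=> //; apply: mx_similar_trans simJ.
case: t01 => [-> | [-> ->]] {simT simA e1 e2 e3 e4 t}.
  (* Diagonal corner. An entry of the last column is sheared away when the eigenvalue of its row
     differs from [c]. Otherwise, if nonzero, it is turned into the 1 of a Jordan block; when both
     survive, a combination of the first two rows removes one of them. *)
  have [-> | ca] := eqVneq c a.
    have [-> | ba] := eqVneq b a.
      have [-> | nz_z] := eqVneq z 0.
        have [-> | nz_y] := eqVneq y 0.
          by exists (mat3 a 0 0 0 a 0 0 0 a); split=> //; apply: mx_similar_refl.
        exists (mat3 a 1 0 0 a 0 0 0 a); split=> //.
        apply: (@mat3_conj _ _ 1 0 0 0 0 y 0 1 0).
          by rewrite !(mulr0, mul0r, mulr1, mul1r, subr0, addr0, sub0r) oppr_eq0.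
        by rewrite !mat3M; congr mat3; ring.
      exists (mat3 a 1 0 0 a 0 0 0 a); split=> //.
      apply: (@mat3_conj _ _ 0 1 0 0 0 z z (- y) 0).
        by rewrite !(mulr0, mul0r, mulr1, mul1r, subr0, addr0, sub0r) opprK mulf_neq0.
      by rewrite !mat3M; congr mat3; ring.
    have {}ba : b - a != 0 by rewrite subr_eq0.
    have [-> | nz_y] := eqVneq y 0.
      exists (mat3 a 0 0 0 b 0 0 0 a); split=> //.
      apply: (@mat3_conj _ _ 1 0 0 0 1 (z / (b - a)) 0 0 1).
        by rewrite !(mulr0, mul0r, mulr1, subr0, addr0) oner_neq0.
      by rewrite !mat3M; congr mat3; field.
    exists (mat3 a 1 0 0 a 0 0 0 b); split=> //.
    apply: (@mat3_conj _ _ 1 0 0 0 0 y 0 1 (z / (b - a))).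
      by rewrite !(mulr0, mul0r, mulr1, mul1r, subr0, addr0, sub0r) oppr_eq0.
    by rewrite !mat3M; congr mat3; field.
  have {}ca : a - c != 0 by rewrite subr_eq0 eq_sym.
  have [-> | cb] := eqVneq b c; last first.
    have {}cb : b - c != 0 by rewrite subr_eq0.
    exists (mat3 a 0 0 0 b 0 0 0 c); split=> //.
    apply: (@mat3_conj _ _ 1 0 (y / (a - c)) 0 1 (z / (b - c)) 0 0 1).
      by rewrite !(mulr0, mul0r, mulr1, subr0, addr0) oner_neq0.
    by rewrite !mat3M; congr mat3; field; rewrite ?ca ?cb.
  have [-> | nz_z] := eqVneq z 0.
    exists (mat3 a 0 0 0 c 0 0 0 c); split=> //.
    apply: (@mat3_conj _ _ 1 0 (y / (a - c)) 0 1 0 0 0 1).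
      by rewrite !(mulr0, mul0r, mulr1, subr0, addr0) oner_neq0.
    by rewrite !mat3M; congr mat3; field.
  exists (mat3 c 1 0 0 c 0 0 0 a); split=> //.
  apply: (@mat3_conj _ _ 0 1 0 0 0 z 1 0 (y / (a - c))).
    by rewrite !(mulr0, mul0r, mulr1, mul1r, subr0, addr0, sub0r) opprK.
  by rewrite !mat3M; congr mat3; field.
have [-> | ca] := eqVneq c a; last first.
  have {}ca : a - c != 0 by rewrite subr_eq0 eq_sym.
  exists (mat3 a 1 0 0 a 0 0 0 c); split=> //.
  apply: (@mat3_conj _ _ 1 0 ((y - z / (a - c)) / (a - c)) 0 1 (z / (a - c)) 0 0 1).
    by rewrite !(mulr0, mul0r, mulr1, subr0, addr0) oner_neq0.
  by rewrite !mat3M; congr mat3; field.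
(* A single eigenvalue over a Jordan corner: a shear absorbs [y], and [z] decides between blocks of
   sizes 2, 1 and one block of size 3. *)
have [-> | nz_z] := eqVneq z 0.
  exists (mat3 a 1 0 0 a 0 0 0 a); split=> //.
  apply: (@mat3_conj _ _ 1 0 0 0 1 y 0 0 1).
    by rewrite !(mulr0, mul0r, mulr1, subr0, addr0) oner_neq0.
  by rewrite !mat3M; congr mat3; ring.
exists (mat3 a 1 0 0 a 1 0 0 a); split.
  by constructor 3; exists a; rewrite jordan3_mat3.
apply: (@mat3_conj _ _ 1 0 0 0 1 y 0 0 z).
  by rewrite !(mulr0, mul0r, mul1r, subr0, addr0).
by rewrite !mat3M; congr mat3; ring.
Qed.

End JordanForm.

(** * Existence: reduction to the list *)

Section Reduction.

Variable K : closedFieldType.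
Implicit Types (A B J : 'M[K]_3) (a b c d : K).

Lemma dualmx_conj A A' B : mx_similar A A' ->
  exists B', mx_similar (dualmx A B) (dualmx A' B').
Proof.
case/mx_similarP=> P [uP eA]; exists (P *m B *m invmx P).
by apply/dualmx_similarP; exists P, 0; rewrite mulmx0 mul0mx !addr0 mulmxKV.
Qed.

Lemma dualmx_mat3_conj A B A' B' p q r s t u v w x :
  p * (t * x - u * w) - q * (s * x - u * v) + r * (s * w - t * v) != 0 ->
  A' *m mat3 p q r s t u v w x = mat3 p q r s t u v w x *m A ->
  B' *m mat3 p q r s t u v w x = mat3 p q r s t u v w x *m B ->
  mx_similar (dualmx A B) (dualmx A' B').
Proof.
move=> nz eA eB; apply/dualmx_similarP; exists (mat3 p q r s t u v w x), 0.
by rewrite unitmxE det_mat3 unitfE mulmx0 mul0mx !addr0.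
Qed.

(** The case [P = 1]: adding a commutator [Q *m A - A *m Q] to the zeta-part leaves the similarity
    class unchanged. This clears the entries outside the canonical positions. *)
Lemma dualmx_gauge A B B' Q :
  B' + A *m Q = B + Q *m A -> mx_similar (dualmx A B) (dualmx A B').
Proof.
by move=> e; apply/dualmx_similarP; exists 1%:M, Q; rewrite unitmx1 !mulmx1 !mul1mx.
Qed.

Definition reducible (X : 'M[dual K]_3) := exists Y, in_list Y /\ mx_similar X Y.

Lemma reducible_similar X Y : mx_similar X Y -> reducible Y -> reducible X.
Proof. move=> sXY [Z [lZ sYZ]]; exists Z; split; [exact: lZ | exact: mx_similar_trans sXY sYZ]. Qed.

Lemma reducible_list X : in_list X -> reducible X.
Proof. by move=> lX; exists X; split=> //; apply: mx_similar_refl. Qed.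

(** The commutator with the diagonal matrix multiplies entry (i, j) of [Q] by a_j - a_i, which is
    invertible off the diagonal, so every off-diagonal entry of [B] can be cancelled. *)
Lemma reducible_distinct a1 a2 a3 B : a1 != a2 -> a1 != a3 -> a2 != a3 ->
  reducible (dualmx (mat3 a1 0 0 0 a2 0 0 0 a3) B).
Proof.
have [b1 [b2 [b3 [b4 [b5 [b6 [b7 [b8 [b9 ->]]]]]]]]] := mat3P B => n12 n13 n23.
have d12 : a1 - a2 != 0 by rewrite subr_eq0.
have d13 : a1 - a3 != 0 by rewrite subr_eq0.
have d23 : a2 - a3 != 0 by rewrite subr_eq0.
have sim : mx_similar (dualmx (mat3 a1 0 0 0 a2 0 0 0 a3) (mat3 b1 b2 b3 b4 b5 b6 b7 b8 b9))
   (dualmx (mat3 a1 0 0 0 a2 0 0 0 a3) (mat3 b1 0 0 0 b5 0 0 0 b9)).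
  apply: (@dualmx_gauge _ _ _ (mat3 0 (b2 / (a1 - a2)) (b3 / (a1 - a3))
    (- b4 / (a1 - a2)) 0 (b6 / (a2 - a3)) (- b7 / (a1 - a3)) (- b8 / (a2 - a3)) 0)).
  by rewrite !mat3M !mat3D; congr mat3; field; rewrite ?d12 ?d13 ?d23.
apply: reducible_similar sim _; apply: reducible_list; left.
by exists a1, a2, a3, b1, b5, b9; rewrite diag_seq_dualnum !diag_mat3.
Qed.

(** Commutators remove the entries linking the two eigenspaces. The centraliser of the reduction
    still contains all invertible 2 x 2 corners, which bring the corner of [B] to Jordan form. *)
Lemma reducible_two_scalar a d B : d != a ->
  reducible (dualmx (mat3 a 0 0 0 a 0 0 0 d) B).
Proof.
have [b1 [b2 [b3 [b4 [b5 [b6 [b7 [b8 [b9 ->]]]]]]]]] := mat3P B => ne.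
have nz : d - a != 0 by rewrite subr_eq0.
have sim1 : mx_similar (dualmx (mat3 a 0 0 0 a 0 0 0 d) (mat3 b1 b2 b3 b4 b5 b6 b7 b8 b9))
   (dualmx (mat3 a 0 0 0 a 0 0 0 d) (mat3 b1 b2 0 b4 b5 0 0 0 b9)).
  apply: (@dualmx_gauge _ _ _ (mat3 0 0 (- b3 / (d - a)) 0 0 (- b6 / (d - a))
    (b7 / (d - a)) (b8 / (d - a)) 0)).
  by rewrite !mat3M !mat3D; congr mat3; field.
apply: reducible_similar sim1 _.
have [p [q [r [s [x [t [y [nzP t01 [e1 e2 e3 e4]]]]]]]]] := jordan_form2 b1 b2 b4 b5.
have sim2 : mx_similar (dualmx (mat3 a 0 0 0 a 0 0 0 d) (mat3 b1 b2 0 b4 b5 0 0 0 b9))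
   (dualmx (mat3 a 0 0 0 a 0 0 0 d) (mat3 x t 0 0 y 0 0 0 b9)).
  apply: (@dualmx_mat3_conj _ _ _ _ p q 0 r s 0 0 0 1).
  - by rewrite !(mulr0, mulr1, subr0, mul0r, addr0).
  - by rewrite !mat3M; congr mat3; ring.
  - by rewrite !mat3M -e1 -e2 -e3 -e4; congr mat3; ring.
apply: reducible_similar sim2 _; apply: reducible_list; right; left.
case: t01 => [-> | [-> ->]].
  constructor 2; exists a, d, b9, (dualmx a%:M (diag_seq 2 [:: x; y])); split=> //.
    by exists x, y.
  by rewrite bordered_dualmx !bordered_mat3 !mxE.
constructor 3; exists a, d, b9, (dualmx a%:M (jordan_block 2 x)); split=> //.
  by exists x.
by rewrite bordered_dualmx !bordered_mat3 !mxE.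
Qed.

(** Inside the Jordan block, commutators clear (1,2) and move (2,2) onto (1,1), keeping the trace
    and (2,1). The entries linking [a] and [d] are solved for by back-substitution, dividing by
    [d - a]. *)
Lemma reducible_two_jordan a d B : d != a ->
  reducible (dualmx (mat3 a 1 0 0 a 0 0 0 d) B).
Proof.
have [b1 [b2 [b3 [b4 [b5 [b6 [b7 [b8 [b9 ->]]]]]]]]] := mat3P B => ne.
have nz : d - a != 0 by rewrite subr_eq0.
have sim : mx_similar (dualmx (mat3 a 1 0 0 a 0 0 0 d) (mat3 b1 b2 b3 b4 b5 b6 b7 b8 b9))
   (dualmx (mat3 a 1 0 0 a 0 0 0 d) (mat3 (b1 + b5) 0 0 b4 0 0 0 0 b9)).
  apply: (@dualmx_gauge _ _ _ (mat3 0 0 (- (b3 + b6 / (d - a)) / (d - a))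
    (- b5) b2 (- b6 / (d - a)) (b7 / (d - a)) ((b8 + b7 / (d - a)) / (d - a)) 0)).
  by rewrite !mat3M !mat3D; congr mat3; field.
apply: reducible_similar sim _; apply: reducible_list; right; left; constructor 1.
exists a, d, b9, (dualmx (jordan_block 2 a) (rows_mx 2 2 [:: [:: b1 + b5; 0]; [:: b4; 0]])).
split=> //; first by exists (b1 + b5), b4.
by rewrite bordered_dualmx !bordered_mat3 !mxE.
Qed.

(** Here [P], with rows (p, q, r), (0, p, 0), (0, s, t), is the general element of the centraliser
    of the reduction. With M and M' the inner 2 x 2 matrices of the b's and c's, the first four
    equations say that M' (p, r; 0, t) = (p, 0; s, t) M. The fifth is the sum of the (1,1) and (2,2)
    entries of the zeta-equation, where [Q] cancels. *)
Lemma jordan21_gauge a p q r s t b11 b21 b23 b31 b33 c11 c21 c23 c31 c33 :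
  p != 0 -> t != 0 ->
  [/\ c21 = b21, c31 * p = s * b21 + t * b31, c21 * r + c23 * t = p * b23,
      c31 * r + c33 * t = s * b23 + t * b33
    & c11 * p + c21 * q + c23 * s = p * b11 + q * b21 + r * b31] ->
  mx_similar (dualmx (mat3 a 1 0 0 a 0 0 0 a) (mat3 b11 0 0 b21 0 b23 b31 0 b33))
             (dualmx (mat3 a 1 0 0 a 0 0 0 a) (mat3 c11 0 0 c21 0 c23 c31 0 c33)).
Proof.
move=> nzp nzt [-> e1 e2 e3 e4]; apply/dualmx_similarP.
(* The second row of [Q] solves the first row of the zeta-equation, and its (3,1) entry solves the
   (3,2) entry; the other entries of [Q] are set to 0. *)
exists (mat3 p q r 0 p 0 0 s t), (mat3 0 0 0
  (- (c11 * p - (p * b11 + q * b21 + r * b31))) (- (c11 * q)) (- (c11 * r - q * b23 - r * b33))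
  (c31 * q + c33 * s) 0 0).
rewrite unitmxE det_mat3 unitfE !mat3M !mat3D; split.
- by rewrite !(mulr0, mul0r, subr0, addr0) !mulf_neq0.
- by congr mat3; ring.
congr mat3; try ring.
- by rewrite -e4; ring.
- by rewrite -e2; ring.
- by rewrite e1; ring.
by transitivity (c31 * r + c33 * t); [ring | rewrite e3; ring].
Qed.

(** Commutators leave five entries, then [jordan21_gauge] acts. A nonzero [b4] clears (2,3) and
    (3,1); failing that, a nonzero [b7] is scaled to 1 and clears (3,3); failing that, a nonzero
    [b6] does the same. The outcomes are the three families of [R2]. *)
Lemma reducible_one_jordan21 a B :
  reducible (dualmx (mat3 a 1 0 0 a 0 0 0 a) B).
Proof.
have [b1 [b2 [b3 [b4 [b5 [b6 [b7 [b8 [b9 ->]]]]]]]]] := mat3P B.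
have sim : mx_similar (dualmx (mat3 a 1 0 0 a 0 0 0 a) (mat3 b1 b2 b3 b4 b5 b6 b7 b8 b9))
   (dualmx (mat3 a 1 0 0 a 0 0 0 a) (mat3 (b1 + b5) 0 0 b4 0 b6 b7 0 b9)).
  apply: (@dualmx_gauge _ _ _ (mat3 0 0 0 (- b5) b2 b3 (- b8) 0 0)).
  by rewrite !mat3M !mat3D; congr mat3; ring.
apply: reducible_similar sim _; move: (b1 + b5) => c1 {b1 b2 b3 b5 b8}.
have formE c11 c21 c23 c31 c33 : R2 (rows_mx 2 2 [:: [:: c21; c23]; [:: c31; c33]]) ->
    reducible (dualmx (mat3 a 1 0 0 a 0 0 0 a) (mat3 c11 0 0 c21 0 c23 c31 0 c33)).
  move=> R2c; apply: reducible_list; right; right; left.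
  by exists a, c11, c21, c23, c31, c33; rewrite jordan21_mat3.
have [-> | nz4] := eqVneq b4 0; last first.
  apply: reducible_similar (formE (c1 + b6 / b4 * b7) b4 0 0 (b9 - b7 / b4 * b6) _).
    apply: (@jordan21_gauge _ 1 0 (b6 / b4) (- b7 / b4) 1); rewrite ?oner_neq0 //.
    by split=> //; field.
  by constructor 1; exists b4, (b9 - b7 / b4 * b6).
have [-> | nz7] := eqVneq b7 0; last first.
  apply: reducible_similar (formE (c1 + b9) 0 (b7 * b6) 1 0 _).
    apply: (@jordan21_gauge _ b7 0 b9 0 1); rewrite ?oner_neq0 //.
    by split=> //; ring.
  by constructor 2; exists (b7 * b6).
have [-> | nz6] := eqVneq b6 0; last first.
  apply: reducible_similar (formE (c1 + b9) 0 1 0 0 _).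
    apply: (@jordan21_gauge _ 1 0 0 (- b9) b6); rewrite ?oner_neq0 //.
    by split=> //; ring.
  by constructor 3.
by apply: formE; constructor 1; exists 0, b9.
Qed.

(** Commutators with a full Jordan block preserve the sums along the main diagonal and the diagonals
    below it, and nothing else; these three sums are collected in the first column. *)
Lemma reducible_one_jordan3 a B :
  reducible (dualmx (mat3 a 1 0 0 a 1 0 0 a) B).
Proof.
have [b1 [b2 [b3 [b4 [b5 [b6 [b7 [b8 [b9 ->]]]]]]]]] := mat3P B.
have sim : mx_similar (dualmx (mat3 a 1 0 0 a 1 0 0 a) (mat3 b1 b2 b3 b4 b5 b6 b7 b8 b9))
   (dualmx (mat3 a 1 0 0 a 1 0 0 a) (mat3 (b1 + b5 + b9) 0 0 (b4 + b8) 0 0 b7 0 0)).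
  apply: (@dualmx_gauge _ _ _ (mat3 (- b2) 0 0 (- b9 - b5) 0 b3 (- b8) (- b9) b6)).
  by rewrite !mat3M !mat3D; congr mat3; ring.
apply: reducible_similar sim _; apply: reducible_list; right; right; right; left.
by exists a, (b1 + b5 + b9), (b4 + b8), b7; rewrite jordan3_mat3.
Qed.

Lemma reducible_one_scalar a B : reducible (dualmx a%:M B).
Proof.
have [J [shape /mx_similarP[P [uP eJ]]]] := jordan_form3 B.
exists (dualmx a%:M J); split; last first.
  apply/dualmx_similarP; exists P, 0.
  by rewrite mulmx0 mul0mx !addr0 scalar_mxC.
right; right; right; right.
by case: shape; [constructor 1 | constructor 2 | constructor 3]; exists a, J.
Qed.

Lemma every_reducible (X : 'M[dual K]_3) : reducible X.
Proof.
have [A [B ->]] := dualmxP X.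
have [J [shape /(@dualmx_conj _ _ B)[B' sim]]] := jordan_form3 A.
apply: reducible_similar sim _; case: shape => [[c1 [c2 [c3 ->]]] | [c [d ->]] | [c ->]].
- rewrite diag_mat3; have [<- | n12] := eqVneq c1 c2.
    have [<- | n13] := eqVneq c3 c1; last exact: reducible_two_scalar.
    by rewrite -scalar_mat3; apply: reducible_one_scalar.
  (* Equal eigenvalues not yet in the first two places are moved there by a permutation matrix, at
     the cost of a new zeta-part [B2]. *)
  have [<- | n13] := eqVneq c1 c3.
    have [B2 sim2] : exists B2, mx_similar (dualmx (mat3 c1 0 0 0 c2 0 0 0 c1) B')
        (dualmx (mat3 c1 0 0 0 c1 0 0 0 c2) B2).
      apply: dualmx_conj; apply: (@mat3_conj _ _ _ 1 0 0 0 0 1 0 1 0); last by rewrite !mat3M; congr mat3; ring.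
      by rewrite !(mulr0, mul0r, mulr1, mul1r, subr0, addr0, sub0r) oppr_eq0 oner_neq0.
    by apply: reducible_similar sim2 _; apply: reducible_two_scalar; rewrite eq_sym.
  have [<- | n23] := eqVneq c2 c3; last exact: reducible_distinct.
  have [B2 sim2] : exists B2, mx_similar (dualmx (mat3 c1 0 0 0 c2 0 0 0 c2) B')
      (dualmx (mat3 c2 0 0 0 c2 0 0 0 c1) B2).
    apply: dualmx_conj; apply: (@mat3_conj _ _ _ 0 1 0 0 0 1 1 0 0); last by rewrite !mat3M; congr mat3; ring.
    by rewrite !(mulr0, mul0r, mulr1, mul1r, subr0, addr0, sub0r, add0r) opprK oner_neq0.
  by apply: reducible_similar sim2 _; apply: reducible_two_scalar.
- rewrite jordan21_mat3; have [-> | ne] := eqVneq d c; last exact: reducible_two_jordan.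
  exact: reducible_one_jordan21.
by rewrite jordan3_mat3; apply: reducible_one_jordan3.
Qed.

End Reduction.

(** * Uniqueness: comparing two forms of the same shape *)

Section Uniqueness.

Variable K : fieldType.
Implicit Types (A B : 'M[K]_3) (a b c d x y : K).

(** Lets [ring] derive one equation from another: its first premise is a polynomial identity. *)
Lemma eq_by_sub (u v x y : K) : u - v = x - y -> x = y -> u = v.
Proof. by move=> e exy; apply/eqP; rewrite -subr_eq0 e exy subrr. Qed.

Lemma eigen_separated x y p : x != y -> x * p = p * y -> p = 0.
Proof.
move=> ne e; apply/eqP; have : (x - y) * p == 0 by rewrite mulrBl e mulrC subrr.
by rewrite mulf_eq0 subr_eq0 (negPf ne).
Qed.

(** The premises say that [(p, q)] is a row with [(p, q) J = x (p, q)] for the upper Jordan block J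
    of eigenvalue [a]; a left eigenvector of such a block has first entry 0. *)
Lemma eigen_chain x a p q : x * p = p * a -> x * q = p + q * a -> p = 0.
Proof.
have [-> _ e | ne e _] := eqVneq x a; last exact: eigen_separated ne e.
by apply: (eq_by_sub _ (esym e)); ring.
Qed.

Lemma mat3_similarE A A' : mx_similar A A' ->
  exists p q r s t u v w x,
    p * (t * x - u * w) - q * (s * x - u * v) + r * (s * w - t * v) != 0 /\
    A' *m mat3 p q r s t u v w x = mat3 p q r s t u v w x *m A.
Proof.
case/mx_similarP=> P [].
have [p [q [r [s [t [u [v [w [x ->]]]]]]]]] := mat3P P.
rewrite unitmxE det_mat3 unitfE => nz e.
by exists p, q, r, s, t, u, v, w, x.
Qed.

Lemma dualmx_mat3_similarE A B A' B' : mx_similar (dualmx A B) (dualmx A' B') ->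
  exists p q r s t u v w x, exists Q,
    [/\ p * (t * x - u * w) - q * (s * x - u * v) + r * (s * w - t * v) != 0,
    A' *m mat3 p q r s t u v w x = mat3 p q r s t u v w x *m A
    & B' *m mat3 p q r s t u v w x + A' *m Q = mat3 p q r s t u v w x *m B + Q *m A].
Proof.
case/dualmx_similarP=> P [Q []].
have [p [q [r [s [t [u [v [w [x ->]]]]]]]]] := mat3P P.
rewrite unitmxE det_mat3 unitfE => nz eA eB.
by exists p, q, r, s, t, u, v, w, x, Q.
Qed.

Lemma dualmx_similar_red n (A B A' B' : 'M[K]_n) :
  mx_similar (dualmx A B) (dualmx A' B') -> mx_similar A A'.
Proof. by case/dualmx_similarP=> P [Q [uP eA _]]; apply/mx_similarP; exists P. Qed.

Lemma dualmx_scalar_similar n (B B' : 'M[K]_n) a :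
  mx_similar (dualmx a%:M B) (dualmx a%:M B') -> mx_similar B B'.
Proof.
case/dualmx_similarP=> P [Q [uP _ eB]]; apply/mx_similarP; exists P.
by split=> //; move: eB; rewrite scalar_mxC => /addIr.
Qed.

(** Up to sign, the determinants are values of the characteristic polynomial at [- x]; in this form
    [det_mat3] computes them. *)
Lemma similar_charpoly_trace n (X Y : 'M[K]_n) : mx_similar X Y ->
  (forall x, \det (Y + x%:M) = \det (X + x%:M)) /\ \tr Y = \tr X.
Proof.
case=> C [uC ->]; split=> [x |]; last by rewrite mxtrace_mulC mulmxA mulVmx ?mul1mx.
have <- : C *m (X + x%:M) *m invmx C = C *m X *m invmx C + x%:M.
  by rewrite mulmxDr mulmxDl scalar_mxC mulmxK.
by rewrite !det_mulmx mulrAC -det_mulmx mulmxV // det1 mul1r.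
Qed.

(** If [a] and [a'] differed, evaluating the characteristic polynomials at these two roots would
    give [d' = a] and [d = a'], and equality of traces would then force [a = a']. *)
Lemma triangular_similar a t w d a' t' w' d' :
  mx_similar (mat3 a t 0 0 a w 0 0 d) (mat3 a' t' 0 0 a' w' 0 0 d') ->
  a = a' /\ d = d'.
Proof.
case/similar_charpoly_trace; rewrite !mxtrace_mat3 => chi tr.
have {}chi x : (a' - x) * (a' - x) * (d' - x) = (a - x) * (a - x) * (d - x).
  by apply: (eq_by_sub _ (chi (- x))); rewrite !scalar_mat3 !mat3D !det_mat3; ring.
have [ea | ne_a] := eqVneq a a'.
  by split=> //; apply: (eq_by_sub _ (esym tr)); rewrite ea; ring.
have ed' : d' = a.
  have /eqP := chi a; rewrite subrr !mul0r !mulf_eq0 !subr_eq0 orbb eq_sym (negPf ne_a).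
  by move/eqP.
have ed : d = a'.
  have /eqP := esym (chi a'); rewrite subrr !mul0r !mulf_eq0 !subr_eq0 orbb (negPf ne_a).
  by move/eqP.
by case/eqP: ne_a; apply: (eq_by_sub _ (esym tr)); rewrite ed ed'; ring.
Qed.

(* The first column of the conjugating matrix is killed row by row. *)
Lemma jordan_not_diag a w d x y z :
  ~ mx_similar (mat3 a 1 0 0 a w 0 0 d) (mat3 x 0 0 0 y 0 0 0 z).
Proof.
case/mat3_similarE=> p1 [p2 [p3 [p4 [p5 [p6 [p7 [p8 [p9 [nz]]]]]]]]].
rewrite !mat3M => /mat3_inj[[e11 e12 _] [[e21 e22 _] [e31 e32 _]]].
have p10 : p1 = 0.
  by apply: (@eigen_chain x a p1 p2);
     [apply: (eq_by_sub _ e11) | apply: (eq_by_sub _ e12)]; ring.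
have p40 : p4 = 0.
  by apply: (@eigen_chain y a p4 p5);
     [apply: (eq_by_sub _ e21) | apply: (eq_by_sub _ e22)]; ring.
have p70 : p7 = 0.
  by apply: (@eigen_chain z a p7 p8);
     [apply: (eq_by_sub _ e31) | apply: (eq_by_sub _ e32)]; ring.
by case/eqP: nz; rewrite p10 p40 p70; ring.
Qed.

(** Again the first column of [P] vanishes row by row. If the eigenvalue of the row differs from
    [a], the reduced equation suffices; if it equals [a], the [Q] terms cancel and [eigen_chain]
    applies to the zeta-equation. *)
Lemma scalar_jordan_not_diag a d c w e x1 x2 x3 y1 y2 y3 :
  ~ mx_similar (dualmx (mat3 a 0 0 0 a 0 0 0 d) (mat3 c 1 0 0 c w 0 0 e))
      (dualmx (mat3 x1 0 0 0 x2 0 0 0 x3) (mat3 y1 0 0 0 y2 0 0 0 y3)).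
Proof.
case/dualmx_mat3_similarE=> p1 [p2 [p3 [p4 [p5 [p6 [p7 [p8 [p9 [Q [nz]]]]]]]]]].
have [q1 [q2 [q3 [q4 [q5 [q6 [q7 [q8 [q9 ->]]]]]]]]] := mat3P Q.
rewrite !mat3M !mat3D => /mat3_inj[[a11 _ _] [[a21 _ _] [a31 _ _]]].
case/mat3_inj=> [[b11 b12 _] [[b21 b22 _] [b31 b32 _]]].
have chain x y p q u v : x * p = p * a -> y * p + x * u = p * c + u * a ->
    y * q + x * v = p + q * c + v * a -> p = 0.
  move=> e0 e1 e2; have [ex | ne] := eqVneq x a; last exact: eigen_separated ne e0.
  by apply: (@eigen_chain y c p q);
    [apply: (eq_by_sub _ e1) | apply: (eq_by_sub _ e2)]; rewrite ex; ring.
have p10 : p1 = 0.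
  by apply: (@chain x1 y1 p1 p2 q1 q2);
     [apply: (eq_by_sub _ a11) | apply: (eq_by_sub _ b11) | apply: (eq_by_sub _ b12)]; ring.
have p40 : p4 = 0.
  by apply: (@chain x2 y2 p4 p5 q4 q5);
     [apply: (eq_by_sub _ a21) | apply: (eq_by_sub _ b21) | apply: (eq_by_sub _ b22)]; ring.
have p70 : p7 = 0.
  by apply: (@chain x3 y3 p7 p8 q7 q8);
     [apply: (eq_by_sub _ a31) | apply: (eq_by_sub _ b31) | apply: (eq_by_sub _ b32)]; ring.
by case/eqP: nz; rewrite p10 p40 p70; ring.
Qed.

(** The nilpotent parts have ranks 1 and 2. In entries, the last two rows of [P] become multiples of
    the second unit vector. *)
Lemma jordan21_not_jordan3 a :
  ~ mx_similar (mat3 a 1 0 0 a 0 0 0 a) (mat3 a 1 0 0 a 1 0 0 a).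
Proof.
case/mat3_similarE=> p1 [p2 [p3 [p4 [p5 [p6 [p7 [p8 [p9 [nz]]]]]]]]].
rewrite !mat3M => /mat3_inj[[e11 e12 e13] [[e21 e22 e23] _]].
have p70 : p7 = 0 by apply: (eq_by_sub _ e21); ring.
have p90 : p9 = 0 by apply: (eq_by_sub _ e23); ring.
have p40 : p4 = 0 by apply: (eq_by_sub _ e11); ring.
have p60 : p6 = 0 by apply: (eq_by_sub _ e13); ring.
by case/eqP: nz; rewrite p70 p90 p40 p60; ring.
Qed.

Lemma two_jordan_similar a d b b' e c c' f : d != a ->
  mx_similar (dualmx (mat3 a 1 0 0 a 0 0 0 d) (mat3 b 0 0 b' 0 0 0 0 e))
             (dualmx (mat3 a 1 0 0 a 0 0 0 d) (mat3 c 0 0 c' 0 0 0 0 f)) ->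
  [/\ b = c, b' = c' & e = f].
Proof.
move=> ne.
case/dualmx_mat3_similarE=> p1 [p2 [p3 [p4 [p5 [p6 [p7 [p8 [p9 [Q [nz]]]]]]]]]].
have [q1 [q2 [q3 [q4 [q5 [q6 [q7 [q8 [q9 ->]]]]]]]]] := mat3P Q.
rewrite !mat3M !mat3D => /mat3_inj[[a11 a12 a13] [[a21 a22 a23] [a31 a32 a33]]].
case/mat3_inj=> [[b11 b12 b13] [[b21 b22 b23] [b31 b32 b33]]].
have p40 : p4 = 0 by apply: (eq_by_sub _ a11); ring.
have p51 : p5 = p1 by apply: (eq_by_sub _ a12); ring.
have p70 : p7 = 0 by apply: eigen_separated ne _; apply: (eq_by_sub _ a31); ring.
have p80 : p8 = 0.
  by apply: eigen_separated ne _; apply: (eq_by_sub _ a32); rewrite p70; ring.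
have nz' : p1 != 0 /\ p9 != 0.
  split; apply: contraNneq nz => p0; rewrite p70 p80 p51 p40 p0; apply/eqP; ring.
have [nz1 nz9] := nz'.
have eb' : b' = c'.
  apply: (mulfI nz1); apply: (eq_by_sub _ (esym b21)); rewrite p40 p70 p51; ring.
split=> //.
  (* The contributions of [Q] to (1,1) and (2,2) are opposite, so only the sum of these two
     equations is free of [Q]. *)
  apply: (mulfI nz1); apply: (eq_by_sub _ (esym (congr2 +%R b11 b22))).
  by rewrite p40 p70 p51 p80 eb'; ring.
by apply: (mulfI nz9); apply: (eq_by_sub _ (esym b33)); rewrite p70 p80; ring.
Qed.

Lemma two_scalar_similar a d b e c f : d != a ->
  mx_similar (dualmx (mat3 a 0 0 0 a 0 0 0 d) (mat3 b 1 0 0 b 0 0 0 e))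
             (dualmx (mat3 a 0 0 0 a 0 0 0 d) (mat3 c 1 0 0 c 0 0 0 f)) ->
  b = c /\ e = f.
Proof.
move=> ne.
case/dualmx_mat3_similarE=> p1 [p2 [p3 [p4 [p5 [p6 [p7 [p8 [p9 [Q [nz]]]]]]]]]].
have [q1 [q2 [q3 [q4 [q5 [q6 [q7 [q8 [q9 ->]]]]]]]]] := mat3P Q.
rewrite !mat3M !mat3D => /mat3_inj[[a11 a12 a13] [[a21 a22 a23] [a31 a32 a33]]].
case/mat3_inj=> [[b11 b12 b13] [[b21 b22 b23] [b31 b32 b33]]].
have p70 : p7 = 0 by apply: eigen_separated ne _; apply: (eq_by_sub _ a31); ring.
have p80 : p8 = 0 by apply: eigen_separated ne _; apply: (eq_by_sub _ a32); ring.
have nz9 : p9 != 0.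
  apply: contraNneq nz => p0; rewrite p70 p80 p0; apply/eqP; ring.
split; last by apply: (mulfI nz9); apply: (eq_by_sub _ (esym b33)); rewrite p70 p80; ring.
(* Distinct [b] and [c] would make the first column of [P] zero. *)
apply/eqP; apply: contraNT nz => nbc.
have p40 : p4 = 0.
  by apply: (@eigen_separated c b); [rewrite eq_sym | apply: (eq_by_sub _ b21); ring].
have p10 : p1 = 0.
  apply: (@eigen_separated c b); [by rewrite eq_sym | apply: (eq_by_sub _ b11)].
  by rewrite p40; ring.
by rewrite p40 p10 p70; apply/eqP; ring.
Qed.

(** The matrix [P] commutes with the Jordan block, hence is upper triangular and constant along
    diagonals. Summing the zeta-equation along the main or a lower diagonal eliminates [Q]; the sums
    are used from the bottom corner upwards. *)
Lemma one_jordan3_similar a b1 b2 b3 c1 c2 c3 :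
  mx_similar (dualmx (mat3 a 1 0 0 a 1 0 0 a) (mat3 b1 0 0 b2 0 0 b3 0 0))
             (dualmx (mat3 a 1 0 0 a 1 0 0 a) (mat3 c1 0 0 c2 0 0 c3 0 0)) ->
  [/\ b1 = c1, b2 = c2 & b3 = c3].
Proof.
case/dualmx_mat3_similarE=> p1 [p2 [p3 [p4 [p5 [p6 [p7 [p8 [p9 [Q [nz]]]]]]]]]].
have [q1 [q2 [q3 [q4 [q5 [q6 [q7 [q8 [q9 ->]]]]]]]]] := mat3P Q.
rewrite !mat3M !mat3D => /mat3_inj[[a11 a12 a13] [[a21 a22 a23] [a31 a32 a33]]].
case/mat3_inj=> [[b11 b12 b13] [[b21 b22 b23] [b31 b32 b33]]].
have p40 : p4 = 0 by apply: (eq_by_sub _ a11); ring.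
have p51 : p5 = p1 by apply: (eq_by_sub _ a12); ring.
have p62 : p6 = p2 by apply: (eq_by_sub _ a13); ring.
have p70 : p7 = 0 by apply: (eq_by_sub _ a21); ring.
have p80 : p8 = 0 by apply: (eq_by_sub _ a22); rewrite p40; ring.
have p91 : p9 = p1 by apply: (eq_by_sub _ a23); rewrite p51; ring.
have nz1 : p1 != 0.
  apply: contraNneq nz => p0; rewrite p40 p51 p62 p70 p80 p91 p0; apply/eqP; ring.
have e3 : b3 = c3.
  apply: (mulfI nz1); apply: (eq_by_sub _ (esym b31)); rewrite p70 p80 p91; ring.
have e2 : b2 = c2.
  apply: (mulfI nz1); apply: (eq_by_sub _ (esym (congr2 +%R b21 b32))).
  by rewrite p40 p51 p62 p70 p80 p91 e3; ring.
split=> //; apply: (mulfI nz1).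
apply: (eq_by_sub _ (esym (congr2 +%R b11 (congr2 +%R b22 b33)))).
by rewrite p40 p51 p62 p70 p80 p91 e2 e3; ring.
Qed.

(** Converse of [jordan21_gauge]: the commutation relation forces the centraliser shape of [P], and
    the five equations are the entries, or sums of entries, not involving [Q]. *)
Lemma one_jordan21_similar a b11 b21 b23 b31 b33 c11 c21 c23 c31 c33 :
  mx_similar (dualmx (mat3 a 1 0 0 a 0 0 0 a) (mat3 b11 0 0 b21 0 b23 b31 0 b33))
             (dualmx (mat3 a 1 0 0 a 0 0 0 a) (mat3 c11 0 0 c21 0 c23 c31 0 c33)) ->
  exists p q r s t, [/\ p != 0, t != 0 &
  [/\ c21 = b21, c31 * p = s * b21 + t * b31, c21 * r + c23 * t = p * b23,
      c31 * r + c33 * t = s * b23 + t * b33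
    & c11 * p + c21 * q + c23 * s = p * b11 + q * b21 + r * b31]].
Proof.
case/dualmx_mat3_similarE=> p1 [p2 [p3 [p4 [p5 [p6 [p7 [p8 [p9 [Q [nz]]]]]]]]]].
have [q1 [q2 [q3 [q4 [q5 [q6 [q7 [q8 [q9 ->]]]]]]]]] := mat3P Q.
rewrite !mat3M !mat3D => /mat3_inj[[a11 a12 a13] [[a21 a22 a23] [a31 a32 a33]]].
case/mat3_inj=> [[b1 b2 b3] [[b4 b5 b6] [b7 b8 b9]]].
have p40 : p4 = 0 by apply: (eq_by_sub _ a11); ring.
have p51 : p5 = p1 by apply: (eq_by_sub _ a12); ring.
have p60 : p6 = 0 by apply: (eq_by_sub _ a13); ring.
have p70 : p7 = 0 by apply: (eq_by_sub _ (esym a32)); ring.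
have nz' : p1 != 0 /\ p9 != 0.
  by split; apply: contraNneq nz => p0; rewrite p40 p51 p60 p70 p0; apply/eqP; ring.
have [nz1 nz9] := nz'.
have e1 : c21 = b21.
  by apply: (mulfI nz1); apply: (eq_by_sub _ b4); rewrite p40 p51 p60 p70; ring.
exists p1, p2, p3, p8, p9; split=> //; split=> //.
- by apply: (eq_by_sub _ b7); rewrite p70; ring.
- by apply: (eq_by_sub _ b6); rewrite p51 p60; ring.
- by apply: (eq_by_sub _ b9); ring.
by apply: (eq_by_sub _ (congr2 +%R b1 b5)); rewrite e1; ring.
Qed.

End Uniqueness.

(** * Comparing all pairs of listed forms *)

Section Classification.

Variable K : fieldType.
Implicit Types (A B : 'M[K]_3) (a d : K).

(* The eigenvalues of [A] are [a], [a], [d]. *)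
Variant nondiag_form a d A B : Prop :=
| TwoJordan b b' e of d != a & A = mat3 a 1 0 0 a 0 0 0 d & B = mat3 b 0 0 b' 0 0 0 0 e
| TwoScalar b e of d != a & A = mat3 a 0 0 0 a 0 0 0 d & B = mat3 b 1 0 0 b 0 0 0 e
| OneJordan21 b11 b21 b23 b31 b33
    of d = a /\ R2 (rows_mx 2 2 [:: [:: b21; b23]; [:: b31; b33]])
    & A = mat3 a 1 0 0 a 0 0 0 a & B = mat3 b11 0 0 b21 0 b23 b31 0 b33
| OneJordan3 b5 b6 b7 of d = a & A = mat3 a 1 0 0 a 1 0 0 a & B = mat3 b5 0 0 b6 0 0 b7 0 0
| OneScalar21 b e of d = a & A = mat3 a 0 0 0 a 0 0 0 a & B = mat3 b 1 0 0 b 0 0 0 e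
| OneScalar3 b of d = a & A = mat3 a 0 0 0 a 0 0 0 a & B = mat3 b 1 0 0 b 1 0 0 b.

Lemma is_diag_mat3_diag a b c : is_diag_mx (mat3 a 0 0 0 b 0 0 0 c).
Proof. exact/is_diag_mat3. Qed.

Lemma diagonal_type_diag (X : 'M[dual K]_3) : diagonal_type X -> is_diag_mx X.
Proof.
case=> [[a1 [a2 [a3 [b1 [b2 [b3 [_ ->]]]]]]] | [a [a4 [b4 [A [[c [c' ->]] _ ->]]]]] |
        [a [J [[c1 [c2 [c3 ->]]] ->]]]].
- by rewrite diag_seq_dualnum is_diag_dualmx !diag_mat3 !is_diag_mat3_diag.
- by rewrite bordered_dualmx is_diag_dualmx !bordered_mat3 !mxE !is_diag_mat3_diag.
by rewrite is_diag_dualmx diag_mat3 scalar_mat3 !is_diag_mat3_diag.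
Qed.

Lemma in_list_cases (X : 'M[dual K]_3) : in_list X ->
  diagonal_type X \/ exists a d A B, nondiag_form a d A B /\ X = dualmx A B.
Proof.
have nd a d A B : nondiag_form a d A B -> diagonal_type (dualmx A B) \/
    exists a' d' A' B', nondiag_form a' d' A' B' /\ dualmx A B = dualmx A' B'.
  by move=> F; right; exists a, d, A, B; split; [exact: F | reflexivity].
case=> [fi | [[ | | ] | [ | [ | [ | | ]]]]].
- by left; constructor 1.
- case=> a [d [e [A [[b [b' ->]] ne ->]]]].
  rewrite bordered_dualmx !bordered_mat3 !mxE /=.
  by apply: nd; apply: (TwoJordan ne).
- by left; constructor 2.
- case=> a [d [e [A [[c ->] ne ->]]]].
  rewrite bordered_dualmx !bordered_mat3 !mxE /=.
  by apply: nd; apply: (TwoScalar ne).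
- case=> a [b11 [b21 [b23 [b31 [b33 [R2b ->]]]]]]; rewrite jordan21_mat3.
  by apply: nd; apply: (OneJordan21 (conj (erefl a) R2b)).
- case=> a [b5 [b6 [b7 ->]]]; rewrite jordan3_mat3.
  by apply: nd; apply: OneJordan3.
- by left; constructor 3.
- case=> a [J [[c [d ->]] ->]]; rewrite jordan21_mat3 scalar_mat3.
  by apply: nd; apply: OneScalar21.
case=> a [J [[c ->] ->]]; rewrite jordan3_mat3 scalar_mat3.
by apply: nd; apply: OneScalar3.
Qed.

Lemma nondiag_form_not_diag a d A B (Y : 'M[dual K]_3) :
  nondiag_form a d A B -> is_diag_mx Y -> ~ mx_similar (dualmx A B) Y.
Proof.
have [A' [B' ->]] := dualmxP Y.
have [a1 [a2 [a3 [a4 [a5 [a6 [a7 [a8 [a9 ->]]]]]]]]] := mat3P A'.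
have [b1 [b2 [b3 [b4 [b5 [b6 [b7 [b8 [b9 ->]]]]]]]]] := mat3P B'.
move=> FX; rewrite is_diag_dualmx => /andP[].
move=> /is_diag_mat3[[-> -> ->] [-> -> ->]] /is_diag_mat3[[-> -> ->] [-> -> ->]].
case: FX => [? ? ? _ -> -> | ? ? _ -> -> | ? ? ? ? ? _ -> -> | ? ? ? _ -> -> |
             ? ? _ -> -> | ? _ -> ->].
- by move/dualmx_similar_red/jordan_not_diag.
- exact: scalar_jordan_not_diag.
- by move/dualmx_similar_red/jordan_not_diag.
- by move/dualmx_similar_red/jordan_not_diag.
- exact: scalar_jordan_not_diag.
exact: scalar_jordan_not_diag.
Qed.

Lemma nondiag_form_triangular a d A B :
  nondiag_form a d A B -> exists t w, A = mat3 a t 0 0 a w 0 0 d.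
Proof.
case=> [? ? ? _ -> _ | ? ? _ -> _ | ? ? ? ? ? [-> _] -> _ | ? ? ? -> -> _ |
        ? ? -> -> _ | ? -> -> _]; by do 2!eexists.
Qed.

Lemma R2_cases (b21 b23 b31 b33 : K) :
  R2 (rows_mx 2 2 [:: [:: b21; b23]; [:: b31; b33]]) ->
  [\/ b23 = 0 /\ b31 = 0, [/\ b21 = 0, b31 = 1 & b33 = 0]
    | [/\ b21 = 0, b23 = 1, b31 = 0 & b33 = 0]].
Proof.
by case=> [[a [b]] | [c] | ] /matrixP e;
  move: (e 0 0) (e 0 1) (e 1 0) (e 1 1); rewrite !mxE /= => e1 e2 e3 e4;
  [constructor 1 | constructor 2 | constructor 3].
Qed.

Lemma R2_similar a b11 b21 b23 b31 b33 c11 c21 c23 c31 c33 :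
  R2 (rows_mx 2 2 [:: [:: b21; b23]; [:: b31; b33]]) ->
  R2 (rows_mx 2 2 [:: [:: c21; c23]; [:: c31; c33]]) ->
  mx_similar (dualmx (mat3 a 1 0 0 a 0 0 0 a) (mat3 b11 0 0 b21 0 b23 b31 0 b33))
             (dualmx (mat3 a 1 0 0 a 0 0 0 a) (mat3 c11 0 0 c21 0 c23 c31 0 c33)) ->
  mat3 b11 0 0 b21 0 b23 b31 0 b33 = mat3 c11 0 0 c21 0 c23 c31 0 c33.
Proof.
move=> /R2_cases Rb /R2_cases Rc.
case/one_jordan21_similar=> p [q [r [s [t [nzp nzt [e0 e1 e2 e3 e4]]]]]]; subst c21.
have absurd_p : p = 0 -> False by move/eqP; rewrite (negPf nzp).
have absurd_t : t = 0 -> False by move/eqP; rewrite (negPf nzt).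
(* Of the nine pairs of [R2] families, the six mixed ones force [p] or [t] to vanish; the three
   others give equality of the remaining entries. *)
case: Rb Rc e1 e2 e3 e4 => [[-> ->] | [-> -> ->] | [-> -> -> ->]];
  case=> [[-> ->] | [eb -> ->] | [eb -> -> ->]] => e1 e2 e3 e4.
- have -> : c33 = b33.
    by apply: (mulfI nzt); apply: (eq_by_sub _ e3); ring.
  have -> // : c11 = b11.
  by apply: (mulfI nzp); apply: (eq_by_sub _ e4); ring.
- by case: absurd_p; apply: (eq_by_sub _ e1); rewrite eb; ring.
- by case: absurd_t; apply: (eq_by_sub _ e2); rewrite eb; ring.
- by case: absurd_t; apply: (eq_by_sub _ (esym e1)); ring.
- have pt : p = t by apply: (eq_by_sub _ e1); ring.
  have ec : c23 = b23 by apply: (mulfI nzp); apply: (eq_by_sub _ e2); rewrite pt; ring.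
  (* This makes the terms [c23 * s] and [r * b31] of the last equation cancel, leaving
     [c11 * p = p * b11]. *)
  have er : r = s * b23 by apply: (eq_by_sub _ e3); ring.
  have -> : c11 = b11.
    by apply: (mulfI nzp); apply: (eq_by_sub _ e4); rewrite er ec; ring.
  by rewrite ec.
- by case: absurd_t; apply: (eq_by_sub _ (esym e1)); ring.
- by case: absurd_p; apply: (eq_by_sub _ (esym e2)); ring.
- by case: absurd_p; apply: (eq_by_sub _ e1); ring.
have s0 : s = 0 by apply: (eq_by_sub _ (esym e3)); ring.
have -> // : c11 = b11.
by apply: (mulfI nzp); apply: (eq_by_sub _ e4); rewrite s0; ring.
Qed.

Lemma nondiag_form_similar a d A B a' d' A' B' :
  nondiag_form a d A B -> nondiag_form a' d' A' B' ->
  mx_similar (dualmx A B) (dualmx A' B') -> A = A' /\ B = B'.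
Proof.
move=> FX FY sim; have [t [w eA]] := nondiag_form_triangular FX.
have [t' [w' eA']] := nondiag_form_triangular FY.
have simA := dualmx_similar_red sim.
have [ea ed] : a = a' /\ d = d' by move: simA; rewrite eA eA'; apply: triangular_similar.
move: eA eA' => _ _; subst a' d'.
have simA' := mx_similar_sym simA.
case: FX FY => [b b' e ne eA eB | b e ne eA eB | b11 b21 b23 b31 b33 [ed R2b] eA eB |
    b5 b6 b7 ed eA eB | b e ed eA eB | b ed eA eB];
  case=> [c c' f ne' eA' eB' | c f ne' eA' eB' | c11 c21 c23 c31 c33 [ed' R2c] eA' eB' |
    c5 c6 c7 ed' eA' eB' | c f ed' eA' eB' | c ed' eA' eB'];
  (* Discarded here are the pairs that disagree on whether [d] equals [a], and those with a Jordan
     block in one reduction and a diagonal reduction on the other side. *)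
  try (by rewrite ?ed ?ed' eqxx in ne); try (by rewrite ?ed ?ed' eqxx in ne');
  rewrite eA eA' in simA simA' sim *; rewrite ?eB ?eB' in sim *;
  try (by case: (jordan_not_diag simA)); try (by case: (jordan_not_diag simA')).
- by have [-> -> ->] := two_jordan_similar ne sim.
- by have [-> ->] := two_scalar_similar ne sim.
- by split=> //; apply: R2_similar sim.
- by case: (jordan21_not_jordan3 simA).
- by case: (jordan21_not_jordan3 simA').
- by have [-> -> ->] := one_jordan3_similar sim.
- move: sim; rewrite -scalar_mat3 => /dualmx_scalar_similar/triangular_similar[-> ->].
  by [].
(* A scalar reduction makes the zeta-parts themselves similar. Once their eigenvalues are
   identified, block sizes 2, 1 against 3 are contradictory. *)
- move: sim; rewrite -scalar_mat3 => /dualmx_scalar_similar simB.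
  by move: (triangular_similar simB) (simB) => [-> ->] /jordan21_not_jordan3.
- move: sim; rewrite -scalar_mat3 => /dualmx_scalar_similar simB.
  by move: (triangular_similar simB) (mx_similar_sym simB) => [-> ->] /jordan21_not_jordan3.
by move: sim; rewrite -scalar_mat3 => /dualmx_scalar_similar/triangular_similar[->].
Qed.

End Classification.

(** The third clause ties [is_diag_mx], used in the second, to the three diagonal types of the list:
    no other listed matrix is diagonal, since none is even similar to a diagonal one. *)
Theorem mainTheorem7 (K : closedFieldType) (char0 : [pchar K] =i pred0) :
  (forall X : 'M[dual K]_3,
     exists Y : 'M[dual K]_3, in_list Y /\ mx_similar X Y) /\
  (forall X Y : 'M[dual K]_3, in_list X -> in_list Y ->
     (mx_similar X Y <->
        X = Y \/ [/\ is_diag_mx X, is_diag_mx Y & diag_permuted X Y])) /\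
  (forall X : 'M[dual K]_3, in_list X ->
     (is_diag_mx X <-> diagonal_type X)).
Proof.
split; first exact: every_reducible.
split=> [X Y lX lY | X lX]; last first.
  split=> [dX |]; last exact: diagonal_type_diag.
  have [//|[a [d [A [B [FX eX]]]]]] := in_list_cases lX.
  case: (nondiag_form_not_diag FX dX); rewrite -eX; exact: mx_similar_refl.
split=> [sim | []]; last 2 first.
- move=> <-; exact: mx_similar_refl.
- case=> dX dY pXY; exact: diag_permuted_similar dX dY pXY.
case: (in_list_cases lX) => [/diagonal_type_diag dX | [a [d [A [B [FX eX]]]]]];
  case: (in_list_cases lY) => [/diagonal_type_diag dY | [a' [d' [A' [B' [FY eY]]]]]].
- by right; split; [exact: dX | exact: dY | exact: diag_similar_permuted].
- case: (nondiag_form_not_diag FY dX); rewrite -eY; exact: mx_similar_sym.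
- by case: (nondiag_form_not_diag FX dY); rewrite -eX.
left; rewrite eX eY in sim *.
have [-> ->] := nondiag_form_similar FX FY sim; reflexivity.
Qed.
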